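(* Let $\nu>-1/2$, $0\le\alpha<1$ and $0\le\lambda<1$. Suppose that $$\lambda S_\nu'''(1)+(5\lambda+1-\lambda\alpha)S_\nu''(1)+(4\lambda-2\lambda\alpha-\alpha+3)S_\nu'(1)+(1-\alpha)S_\nu(1)\le 2(1-\alpha).$$ Then the normalized Bessel-Struve kernel function $z\mapsto zS_\nu(z)$ belongs to $\mathcal{L}_\lambda(\alpha)$.
   Context: Let $\mathbb{D}=\{z\in\mathbb{C}:|z|<1\}$. $\mathcal{A}$ denotes the class of functions $f$ analytic and univalent (injective) in $\mathbb{D}$, normalized by $f(0)=0$, $f'(0)=1$. For $\nu>-1$ the Bessel-Struve kernel function is the entire function $$S_\nu(z)=\sum_{n\ge 0}\frac{\Gamma(\nu+1)\,\Gamma\left(\frac{n+1}{2}\right)}{\sqrt{\pi}\,n!\,\Gamma\left(\frac n2+\nu+1\right)}z^n .$$ For $0\le\alpha<1$ and $0\le\lambda<1$, $$\mathcal{L}_\lambda(\alpha)=\left\{f\in\mathcal{A}:\ \operatorname{Re}\left(\frac{\lambda z^3f'''(z)+(1+2\lambda)z^2f''(z)+zf'(z)}{zf'(z)+\lambda z^2f''(z)}\right)>\alpha\ \text{ for all } z\in\mathbb{D}\right\},$$ where the quotient is understood to have the value $1$ at $z=0$ (removable singularity). *)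

(* Defs.v *)
From HB Require Import structures.
From mathcomp Require Import all_boot all_order all_algebra.
From mathcomp Require Import complex.
From mathcomp Require Import all_classical all_reals all_analysis.

Set Implicit Arguments.
Unset Strict Implicit.
Unset Printing Implicit Defensive.

Import Order.TTheory GRing.Theory Num.Theory.
Import numFieldNormedType.Exports.

Local Open Scope ring_scope.
Local Open Scope complex_scope.
Local Open Scope classical_set_scope.

(* R[i] packed as a numClosedFieldType: R[i] by itself has no topology in
   MathComp-Analysis (its canonical module structure is over R), whereas any
   numClosedFieldType C is a normed C-module.  Hence derivable f z 1 and derive1 f
   for f : Cplx R -> Cplx R are complex differentiability and the complex
   derivative. *)
Definition Cplx (R : realType) : numClosedFieldType := R[i].

Definition unit_disc (R : realType) : set (Cplx R) :=
  [set z : Cplx R | `|z| < 1].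
Arguments unit_disc : clear implicits.

(* Analytic = complex differentiable at every point; A is meant to be open. *)
Definition analytic_in (R : realType) (A : set (Cplx R))
    (f : Cplx R -> Cplx R) : Prop :=
  forall z, A z -> derivable f z 1.

Definition classA (R : realType) : set (Cplx R -> Cplx R) :=
  [set f | [/\ analytic_in (unit_disc R) f,
               {in unit_disc R &, injective f},
               f 0 = 0
             & derive1 f 0 = 1]].
Arguments classA : clear implicits.

(* Euler's integral; this is the Gamma function for x > 0 only, which covers
   every argument below since nu > -1. *)
Definition Gamma (R : realType) (x : R) : R :=
  (\int[lebesgue_measure]_(t in `]0%R, +oo[) (t `^ (x - 1) * expR (- t)))%R.

Definition struve_coef (R : realType) (nu : R) (n : nat) : R :=
  Gamma (nu + 1) * Gamma (n.+1%:R / 2)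
    / (Num.sqrt pi * n`!%:R * Gamma (n%:R / 2 + nu + 1)).

(* The Bessel-Struve kernel function, for nu > -1. *)
Definition struve (R : realType) (nu : R) (z : Cplx R) : Cplx R :=
  limn (series (fun n => (struve_coef nu n)%:C * z ^+ n : Cplx R)).

(* At z != 0 the quotient is 0 when its denominator vanishes, so that
   membership in classL, which requires a real part > alpha >= 0, forces the
   denominator to be nonzero on the punctured disc. *)
Definition quotL (R : realType) (lambda : R) (f : Cplx R -> Cplx R)
    (z : Cplx R) : Cplx R :=
  if z == 0 then 1 else
  (lambda%:C * z ^+ 3 * derive1n 3 f z + (1 + 2 * lambda)%:C * z ^+ 2 * derive1n 2 f z
     + z * derive1 f z)
  / (z * derive1 f z + lambda%:C * z ^+ 2 * derive1n 2 f z).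

Definition classL (R : realType) (lambda alpha : R) :
    set (Cplx R -> Cplx R) :=
  [set f | classA R f /\
           forall z, unit_disc R z -> alpha < complex.Re (quotL lambda f z)].

(* Main.v *)
(* Write z S_nu(z) = sum_(m >= 1) a_m z^m with a_1 = 1 and a_m >= 0.  Evaluating
   the derivatives of S_nu at 1, the hypothesis says exactly that
     sum_(m >= 2) m (m - alpha) (1 + lambda (m - 1)) a_m <= 1 - alpha.
   Since m - alpha >= 2 - alpha, this gives sum_(m >= 2) m a_m < 1, so f(z) - z
   contracts the disc and f is univalent.  The denominator of the quotient is
   D = sum b_m z^m with b_m = m (1 + lambda (m - 1)) a_m, and its numerator is
   sum m b_m z^m = D + M.  As (m - 1) b_m + (1 - alpha) b_m = (m - alpha) b_m, the
   hypothesis yields |M| < (1 - alpha) |D|, hence |(D + M) / D - 1| < 1 - alpha.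
   That S_nu is entire follows from Gamma(x) <= sqrt(pi) + Gamma(y) for
   1/2 <= x <= y (split the integral at t = 1), which bounds the coefficients
   by K / n!; a_1 = 1 is Gamma(1/2) = sqrt(pi). *)

Require Import Defs.
From HB Require Import structures.
From mathcomp Require Import all_boot all_order all_algebra.
From mathcomp Require Import complex.
From mathcomp Require Import all_classical all_reals all_analysis.
From mathcomp Require Import measurable_realfun ring lra.

Set Implicit Arguments.
Unset Strict Implicit.
Unset Printing Implicit Defensive.

Import Order.TTheory GRing.Theory Num.Theory.
Import numFieldNormedType.Exports.

Local Open Scope ring_scope.
Local Open Scope complex_scope.
Local Open Scope classical_set_scope.

(** * Power series with real coefficients *)

(* [x%:C] with its type fixed to [Cplx R], so that the algebraic structure is
   always inferred on [Cplx R] and never on [R[i]]. *)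
Definition toC (R : realType) (x : R) : Cplx R := x%:C.

Local Notation "x %:K" := (toC x) (at level 2, format "x %:K").

HB.instance Definition _ (R : realType) :=
  GRing.RMorphism.copy (@toC R) (real_complex R).

Lemma ler_toC (R : realType) (x y : R) : (x%:K <= y%:K) = (x <= y).
Proof. exact: lecR. Qed.

Lemma ltr_toC (R : realType) (x y : R) : (x%:K < y%:K) = (x < y).
Proof. exact: ltcR. Qed.

Lemma toC_ge0 (R : realType) (x : R) : (0 <= x%:K) = (0 <= x).
Proof. exact: ler0c. Qed.

Lemma toC_gt0 (R : realType) (x : R) : (0 < x%:K) = (0 < x).
Proof. exact: ltcR. Qed.

Lemma normr_toC (R : realType) (x : R) : `|x%:K| = `|x|%:K.
Proof.
rewrite [LHS]normc_def /= expr0n addr0 sqrtr_sqr.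
by [].
Qed.

Lemma normr_toCP (R : realType) (z : Cplx R) : exists2 r : R, 0 <= r & `|z| = r%:K.
Proof. by rewrite normc_def; eexists; last reflexivity; exact: sqrtr_ge0. Qed.

(** In the order of [Cplx R] a positive number has zero imaginary part; this turns the complex [e]
    of a limit statement into a real one. *)
Lemma gt0_toCP (R : realType) (e : Cplx R) :
  0 < e -> exists2 r : R, 0 < r & e = r%:K.
Proof.
case: e => a b; rewrite ltcE /= => /andP[/eqP -> a0].
by exists a.
Qed.

Lemma normr_Re (R : realType) (z : Cplx R) : `|complex.Re z|%:K <= `|z|.
Proof. exact: normc_ge_Re. Qed.

Lemma normr_Im (R : realType) (z : Cplx R) : `|complex.Im z|%:K <= `|z|.
Proof.
rewrite -normrN -ReiNIm (le_trans (normc_ge_Re _))//.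
by rewrite normrM complexiE (@normCi (Cplx R)) mulr1.
Qed.

Lemma normr_ReIm (R : realType) (z : Cplx R) :
  `|z| <= (`|complex.Re z| + `|complex.Im z|)%:K.
Proof.
have zE : z = (complex.Re z)%:K + 'i * (complex.Im z)%:K.
  by rewrite -complexiE [LHS]complexE.
rewrite [in leLHS]zE.
apply: (le_trans (ler_normD _ _)).
by rewrite normrM normCi mul1r !normr_toC -rmorphD.
Qed.

Lemma cvg_ReIm (R : realType) (u : nat -> Cplx R) (l : Cplx R) :
  complex.Re (u n) @[n --> \oo] --> complex.Re l ->
  complex.Im (u n) @[n --> \oo] --> complex.Im l ->
  u n @[n --> \oo] --> l.
Proof.
move=> ux uy; apply/cvgrPdist_le => _ /gt0_toCP[e e0 ->].
have e20 : 0 < e / 2 by rewrite divr_gt0.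
near=> n.
apply: (le_trans (normr_ReIm _)); rewrite ler_toC [e]splitr.
have -> : complex.Re (l - u n) = complex.Re l - complex.Re (u n).
  by case: (l) (u n) => [? ?] [? ?].
have -> : complex.Im (l - u n) = complex.Im l - complex.Im (u n).
  by case: (l) (u n) => [? ?] [? ?].
apply: lerD.
  near: n; exact: (cvgrPdist_le _ _).1.
near: n; exact: (cvgrPdist_le _ _).1.
Unshelve. all: by end_near.
Qed.

(** If [|l| = r > M], a term within [(r - M) / 2] of [l] would force [r <= (r + M) / 2]. *)
Lemma cvg_normC_le (R : realType) (u : nat -> Cplx R) (l : Cplx R) (M : R) :
  u n @[n --> \oo] --> l -> (forall n, `|u n| <= M%:K) -> `|l| <= M%:K.
Proof.
move=> ul uM; have [r _ lr] := normr_toCP l.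
rewrite lr ler_toC leNgt; apply/negP => Mr.
have e0 : 0 < (r - M) / 2 by rewrite divr_gt0 ?subr_gt0.
have /cvgrPdist_le /(_ ((r - M) / 2)%:K) := ul.
rewrite ltr_toC => /(_ e0)[N _ /(_ N (leqnn N)) lu].
have : `|l| <= ((r - M) / 2 + M)%:K.
  by rewrite -[l](subrK (u N)) rmorphD /=; apply: (le_trans (ler_normD _ _)); exact: lerD.
by rewrite lr ler_toC; lra.
Qed.

Lemma cvgC_unique (R : realType) (u : nat -> Cplx R) (l : Cplx R) :
  u n @[n --> \oo] --> l -> limn u = l.
Proof. by move=> ul; apply: cvg_lim => //; exact: norm_hausdorff. Qed.

(** * Entire coefficient sequences and their power series *)

Definition entire_coef (R : realType) (a : nat -> R) :=
  forall r, 0 <= r -> exists M, forall n, `|a n| * r ^+ n <= M.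

Definition pser (R : realType) (a : nat -> R) (z : Cplx R) : Cplx R :=
  limn (series (fun n => (a n)%:K * z ^+ n : Cplx R)).

(** The bound at radius [2 * r] dominates the terms at radius [r] by [M / 2 ^ n]. Hence bounded
    terms at every radius, a condition easy to propagate, already give absolute convergence. *)
Lemma entire_summable (R : realType) (a : nat -> R) (r : R) :
  entire_coef a -> 0 <= r -> cvgn (series (fun n => `|a n| * r ^+ n)).
Proof.
move=> ea r0; have [M aM] := ea (2 * r) (mulr_ge0 (ler0n _ 2) r0).
have M0 : 0 <= M by apply: le_trans (aM 0%N); rewrite mulr_ge0 ?exprn_ge0// mulr_ge0.
apply: (@series_le_cvg _ _ (geometric M (2^-1))).
- by move=> n; rewrite mulr_ge0 ?exprn_ge0.
- by move=> n /=; rewrite mulr_ge0 ?exprn_ge0// invr_ge0.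
- move=> n /=; rewrite exprVn ler_pdivlMr ?exprn_gt0//.
  by apply: le_trans (aM n); rewrite exprMn mulrAC mulrA.
- by apply: is_cvg_geometric_series; rewrite ger0_norm ?invr_ge0// invf_lt1 ?ltr1n.
Qed.

Lemma entire_coefD (R : realType) (a b : nat -> R) :
  entire_coef a -> entire_coef b -> entire_coef (fun n => a n + b n).
Proof.
move=> ea eb r r0; have [M aM] := ea r r0; have [N bN] := eb r r0.
exists (M + N) => n; apply: le_trans (lerD (aM n) (bN n)).
by rewrite -mulrDl ler_wpM2r ?exprn_ge0// ler_normD.
Qed.

Lemma entire_coefZ (R : realType) (c : R) (a : nat -> R) :
  entire_coef a -> entire_coef (fun n => c * a n).
Proof.
move=> ea r r0; have [M aM] := ea r r0.
by exists (`|c| * M) => n; rewrite normrM -mulrA ler_wpM2l.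
Qed.

(** The factor [n <= 2 ^ n] is absorbed by doubling the radius. *)
Lemma entire_coefMn (R : realType) (a : nat -> R) :
  entire_coef a -> entire_coef (fun n => n%:R * a n).
Proof.
move=> ea r r0; have [M aM] := ea (2 * r) (mulr_ge0 (ler0n _ 2) r0).
exists M => n; apply: le_trans (aM n).
rewrite normrM normr_nat mulrAC [leRHS]mulrC exprMn ler_wpM2r//.
by rewrite ler_wpM2r ?exprn_ge0// -natrX ler_nat ltnW// ltn_expl.
Qed.

Lemma entire_coefS (R : realType) (a : nat -> R) :
  entire_coef a -> entire_coef (fun n => a n.+1).
Proof.
move=> ea r r0.
(* The radius [1 + r] avoids a division by [r], which may be 0. *)
have [M aM] := ea (1 + r) (addr_ge0 ler01 r0).
exists M => n; apply: le_trans (aM n.+1); rewrite ler_wpM2l//.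
apply: (@le_trans _ _ ((1 + r) ^+ n)).
  by apply: lerXn2r; rewrite ?nnegrE ?addr_ge0// lerDr.
by rewrite exprS ler_peMl ?exprn_ge0 ?addr_ge0// lerDl.
Qed.

Lemma entire_coef_horner (R : realType) (p : {poly R}) (a : nat -> R) :
  entire_coef a -> entire_coef (fun n => p.[n%:R] * a n).
Proof.
move=> ea; elim/poly_ind: p => [|p c IH].
  by move=> r _; exists 0 => n; rewrite horner0 mul0r normr0 mul0r.
rewrite (_ : (fun _ => _) = (fun n => n%:R * (p.[n%:R] * a n) + c * a n)).
  exact: entire_coefD (entire_coefMn IH) (entire_coefZ _ ea).
by apply/funext => n; rewrite hornerMXaddC; ring.
Qed.

Lemma entire_coef_shift (R : realType) (a : nat -> R) :
  entire_coef a -> entire_coef (fun n => if n is m.+1 then a m else 0).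
Proof.
move=> ea r r0; have [M aM] := ea r r0.
exists (r * M) => -[|n].
  rewrite normr0 mul0r mulr_ge0//; apply: le_trans (aM 0%N).
  by rewrite mulr_ge0 ?exprn_ge0.
by rewrite exprS mulrCA ler_wpM2l.
Qed.

Lemma Re_series (R : realType) (u : nat -> Cplx R) (n : nat) :
  complex.Re (series u n) = series (fun i => complex.Re (u i)) n.
Proof. by apply: (big_morph (@complex.Re R)) => // -[? ?] [? ?]. Qed.

Lemma Im_series (R : realType) (u : nat -> Cplx R) (n : nat) :
  complex.Im (series u n) = series (fun i => complex.Im (u i)) n.
Proof. by apply: (big_morph (@complex.Im R)) => // -[? ?] [? ?]. Qed.

Lemma pser_cvg (R : realType) (a : nat -> R) (z : Cplx R) :
  entire_coef a ->
  series (fun n => (a n)%:K * z ^+ n : Cplx R) n @[n --> \oo] --> pser a z.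
Proof.
move=> ea; have [s s0 zs] := normr_toCP z.
have term_le n : `|(a n)%:K * z ^+ n : Cplx R| = (`|a n| * s ^+ n)%:K.
  by rewrite normrM normrX zs normr_toC rmorphM rmorphXn.
pose u n : Cplx R := (a n)%:K * z ^+ n.
have cRe : cvgn (series (fun n => complex.Re (u n))).
  apply: normed_cvg; apply: (@series_le_cvg _ _ (fun n => `|a n| * s ^+ n)) => //=.
  - by move=> n; rewrite mulr_ge0 ?exprn_ge0.
  - by move=> n; rewrite -ler_toC -term_le; exact: normr_Re.
  - exact: entire_summable.
have cIm : cvgn (series (fun n => complex.Im (u n))).
  apply: normed_cvg; apply: (@series_le_cvg _ _ (fun n => `|a n| * s ^+ n)) => //=.
  - by move=> n; rewrite mulr_ge0 ?exprn_ge0.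
  - by move=> n; rewrite -ler_toC -term_le; exact: normr_Im.
  - exact: entire_summable.
suff cu : series u n @[n --> \oo] --> ((limn (series (fun n => complex.Re (u n))))
    +i* (limn (series (fun n => complex.Im (u n)))) : Cplx R).
  by rewrite /pser (cvgC_unique cu).
apply: cvg_ReIm.
  by rewrite (_ : (fun _ => _) = series (fun n => complex.Re (u n)))//;
    apply/funext => n; exact: Re_series.
by rewrite (_ : (fun _ => _) = series (fun n => complex.Im (u n)))//;
  apply/funext => n; exact: Im_series.
Qed.

(** The factor [d] stays outside the real majorant; it is later 1, [|w - z|] or [|w - z| ^ 2]. *)
Lemma cvg_series_normC_le (R : realType) (u : nat -> Cplx R) (l d : Cplx R)
    (b : nat -> R) :
  series u n @[n --> \oo] --> l -> 0 <= d -> (forall n, 0 <= b n) ->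
  (forall n, `|u n| <= (b n)%:K * d) -> cvgn (series b) ->
  `|l| <= (limn (series b))%:K * d.
Proof.
move=> ul /ger0_norm; have [r r0 ->] := normr_toCP d.
move=> <- b0 ub cb; rewrite -rmorphM; apply: (cvg_normC_le ul) => n.
apply: (le_trans (ler_norm_sum _ _ _)).
apply: (@le_trans _ _ ((series b n)%:K * r%:K)).
  by rewrite rmorph_sum mulr_suml /=; apply: ler_sum.
rewrite -rmorphM ler_toC ler_wpM2r//; apply: nondecreasing_cvgn_le => //.
by apply/nondecreasing_seqP => k; rewrite !seriesEnat /= big_nat_recr//= lerDl.
Qed.

Lemma entire_abs_summable (R : realType) (a : nat -> R) :
  entire_coef a -> cvgn (series (fun n => `|a n|)).
Proof.
move=> ea; have := entire_summable ea ler01.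
by under [fun i => _ * _]eq_fun do rewrite expr1n mulr1.
Qed.

Lemma pser1 (R : realType) (a : nat -> R) :
  entire_coef a -> pser a 1 = (limn (series a))%:K.
Proof.
move=> ea; apply: cvgC_unique; apply: cvg_ReIm.
  under eq_fun do rewrite Re_series.
  under eq_fun do under [fun i => _]eq_fun do rewrite expr1n mulr1 /=.
  by apply: normed_cvg; exact: entire_abs_summable.
under eq_fun do rewrite Im_series.
under eq_fun do under [fun i => _]eq_fun do rewrite expr1n mulr1 /=.
rewrite (_ : (fun _ => _) = fun _ => 0) ?funeqE; first exact: cvg_cst.
by move=> n; rewrite /series /= big1.
Qed.

Lemma pserD (R : realType) (a b : nat -> R) (z : Cplx R) :
  entire_coef a -> entire_coef b ->
  pser (fun n => a n + b n) z = pser a z + pser b z.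
Proof.
move=> ea eb; apply: cvgC_unique.
rewrite (_ : series _ = (series (fun n => (a n)%:K * z ^+ n : Cplx R)
                         + series (fun n => (b n)%:K * z ^+ n : Cplx R))).
  by apply: cvgD; exact: pser_cvg.
apply/funext => n; rewrite /series /= -[RHS]big_split /=.
by apply: eq_bigr => i _; rewrite rmorphD mulrDl.
Qed.

Lemma pserZ (R : realType) (c : R) (a : nat -> R) (z : Cplx R) :
  entire_coef a -> pser (fun n => c * a n) z = c%:K * pser a z.
Proof.
move=> ea; apply: cvgC_unique.
rewrite (_ : series _ =
    (fun n => c%:K * series (fun n => (a n)%:K * z ^+ n : Cplx R) n)).
  by apply: cvgMl_tmp; exact: pser_cvg.
apply/funext => n; rewrite /series /= mulr_sumr.
by apply: eq_bigr => i _; rewrite rmorphM mulrA.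
Qed.

Lemma pser_recl (R : realType) (a : nat -> R) (z : Cplx R) :
  entire_coef a -> pser a z = (a 0%N)%:K + z * pser (fun n => a n.+1) z.
Proof.
move=> ea; apply: cvgC_unique; rewrite -cvg_shiftS.
rewrite (_ : [sequence _]_n = (fun n => (a 0%N)%:K
    + z * series (fun n => (a n.+1)%:K * z ^+ n : Cplx R) n)).
  apply: cvgD; first exact: cvg_cst.
  by apply: cvgMl_tmp; exact: pser_cvg (entire_coefS ea).
apply/funext => n; rewrite /series /= big_nat_recl// expr0 mulr1 mulr_sumr.
by congr (_ + _); apply: eq_bigr => i _; rewrite exprS mulrCA.
Qed.

Lemma pser_shiftn (R : realType) (a : nat -> R) (k : nat) (z : Cplx R) :
  entire_coef a -> (forall n, (n < k)%N -> a n = 0) ->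
  z ^+ k * pser (fun n => a (n + k)%N) z = pser a z.
Proof.
elim: k a => [|k IH] a ea a0.
  by rewrite mul1r; congr (pser _ z); apply/funext => n; rewrite addn0.
rewrite [RHS]pser_recl// a0// rmorph0 add0r -[in RHS]IH//; last 2 first.
- exact: entire_coefS.
- by move=> n nk; rewrite a0.
by rewrite exprS mulrA; congr (_ * pser _ z); apply/funext => n; rewrite addnS.
Qed.

(** Identities between sums of real series are read off from those of [pser] at 1, as the embedding
    of the reals is injective. *)
Lemma lim_series_recl (R : realType) (a : nat -> R) :
  entire_coef a -> limn (series a) = a 0%N + limn (series (fun n => a n.+1)).
Proof.
move=> ea; have := pser_recl 1 ea.
rewrite mul1r !pser1//; last exact: entire_coefS.
by rewrite -rmorphD => /complexI.
Qed.

Lemma pser_normC_le (R : realType) (a : nat -> R) (z : Cplx R) :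
  entire_coef a -> `|z| <= 1 -> `|pser a z| <= (limn (series (fun n => `|a n|)))%:K.
Proof.
move=> ea z1; rewrite -[leRHS]mulr1.
apply: (cvg_series_normC_le (pser_cvg ea)) => //; last exact: entire_abs_summable.
by move=> n; rewrite normrM normrX normr_toC ler_wpM2l ?toC_ge0// exprn_ile1.
Qed.

(** * Difference estimates and termwise differentiation *)

Lemma exprB_lipschitz (F : numDomainType) (w z : F) (n : nat) :
  `|w| <= 1 -> `|z| <= 1 -> `|w ^+ n - z ^+ n| <= n%:R * `|w - z|.
Proof.
move=> w1 z1; elim: n => [|n IH]; first by rewrite subrr normr0 mul0r.
rewrite (_ : _ - _ = w * (w ^+ n - z ^+ n) + (w - z) * z ^+ n); last first.
  by rewrite !exprS; ring.
rewrite (le_trans (ler_normD _ _))// -natr1 [leRHS]mulrDl mul1r lerD//.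
  by rewrite normrM (le_trans _ IH)// ler_piMl.
by rewrite normrM ler_piMr// normrX exprn_ile1.
Qed.

(** The remainders satisfy [R_(n+1) = w R_n + n z^(n-1) (w - z)^2], and [n^2 + n <= (n + 1)^2]
    closes the induction. Since [1 <= r], powers of [r] can be raised to a common exponent; at
    [n = 0] the truncated [n.-1] is multiplied by 0. *)
Lemma exprB_taylor1 (F : numDomainType) (w z r : F) (n : nat) :
  1 <= r -> `|w| <= r -> `|z| <= r ->
  `|w ^+ n - z ^+ n - (w - z) * (n%:R * z ^+ n.-1)| <=
    (n%:R * n%:R * r ^+ n) * `|w - z| ^+ 2.
Proof.
move=> r1 wr zr; have r0 : 0 <= r := le_trans ler01 r1.
elim: n => [|n IH]; first by rewrite subrr !mul0r mulr0 subr0 normr0.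
rewrite (_ : _ - _ = w * (w ^+ n - z ^+ n - (w - z) * (n%:R * z ^+ n.-1))
    + n%:R * z ^+ n.-1 * (w - z) ^+ 2); last first.
  case: n {IH} => [|n]; first by rewrite /=; ring.
  by rewrite /= !exprS -!natr1; ring.
apply: (le_trans (ler_normD _ _)).
apply: (@le_trans _ _ ((n%:R * n%:R * r ^+ n.+1 + n%:R * r ^+ n.+1) * `|w - z| ^+ 2)).
  rewrite [leRHS]mulrDl lerD// normrM.
    rewrite [r ^+ n.+1]exprS
      (_ : _ * (r * _) * _ = r * (n%:R * n%:R * r ^+ n * `|w - z| ^+ 2)); last by ring.
    exact: ler_pM.
  rewrite normrX ler_wpM2r ?exprn_ge0// normrM normr_nat ler_wpM2l// normrX.
  apply: (@le_trans _ _ (r ^+ n.-1)); first by apply: lerXn2r; rewrite ?nnegrE.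
  by apply: ler_weXn2l => //; exact: leq_trans (leq_pred n) _.
rewrite ler_wpM2r ?exprn_ge0// -mulrDl ler_wpM2r ?exprn_ge0//.
by rewrite -!natrM -natrD ler_nat mulSn mulnS [(n * n + n)%N]addnC leq_addl.
Qed.

Definition dcoef (R : realType) (a : nat -> R) (n : nat) : R := n.+1%:R * a n.+1.

Lemma entire_dcoef (R : realType) (a : nat -> R) :
  entire_coef a -> entire_coef (dcoef a).
Proof. by move=> /entire_coefMn /entire_coefS. Qed.

Lemma dcoef_cvg (R : realType) (a : nat -> R) (z : Cplx R) :
  entire_coef a ->
  series (fun n => (a n)%:K * (n%:R * z ^+ n.-1)) n @[n --> \oo]
    --> pser (dcoef a) z.
Proof.
move=> ea; rewrite -cvg_shiftS.
rewrite (_ : [sequence _]_n = series (fun n => (dcoef a n)%:K * z ^+ n)).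
  exact: pser_cvg (entire_dcoef ea).
apply/funext => n; rewrite /series /= big_nat_recl// mul0r mulr0 add0r.
by apply: eq_bigr => i _; rewrite /dcoef rmorphM rmorph_nat /=; ring.
Qed.

Lemma pser_lipschitz (R : realType) (a : nat -> R) (w z : Cplx R) :
  entire_coef a -> `|w| <= 1 -> `|z| <= 1 ->
  `|pser a w - pser a z| <= (limn (series (fun n => n%:R * `|a n|)))%:K * `|w - z|.
Proof.
move=> ea w1 z1.
have sn : cvgn (series (fun n => n%:R * `|a n|)).
  have := entire_abs_summable (entire_coefMn ea).
  by under eq_fun do rewrite normrM normr_nat.
apply: (@cvg_series_normC_le _ (fun n => (a n)%:K * (w ^+ n - z ^+ n))) => //.
- rewrite (_ : (fun n => series _ _) = (series (fun n => (a n)%:K * w ^+ n)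
    - series (fun n => (a n)%:K * z ^+ n))).
    by apply: cvgB; exact: pser_cvg.
  apply/funext => n; rewrite /series /= -[RHS]sumrB.
  by apply: eq_bigr => i _; rewrite mulrBr.
- move=> n; rewrite normrM normr_toC rmorphM rmorph_nat /= -mulrA mulrCA.
  by rewrite ler_wpM2l ?toC_ge0// exprB_lipschitz.
Qed.

(** Summing [exprB_taylor1] over [n]; the majorant converges because multiplying twice by [n] keeps
    a sequence entire. *)
Lemma pser_taylor1 (R : realType) (a : nat -> R) (r : R) :
  entire_coef a -> 1 <= r ->
  exists M : R, forall w z : Cplx R, `|w| <= r%:K -> `|z| <= r%:K ->
    `|pser a w - pser a z - (w - z) * pser (dcoef a) z| <= M%:K * `|w - z| ^+ 2.
Proof.
move=> ea r1; have r0 : 0 <= r := le_trans ler01 r1.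
have sn : cvgn (series (fun n => n%:R * n%:R * `|a n| * r ^+ n)).
  have := entire_summable (entire_coefMn (entire_coefMn ea)) r0.
  by under eq_fun do rewrite mulrA normrM -natrM normr_nat natrM.
exists (limn (series (fun n => n%:R * n%:R * `|a n| * r ^+ n))) => w z wr zr.
apply: (@cvg_series_normC_le _ (fun n => (a n)%:K *
    (w ^+ n - z ^+ n - (w - z) * (n%:R * z ^+ n.-1)))) => //.
- rewrite (_ : (fun n => series _ _) = (series (fun n => (a n)%:K * w ^+ n)
    - series (fun n => (a n)%:K * z ^+ n))
    - (fun n => (w - z) * series (fun n => (a n)%:K * (n%:R * z ^+ n.-1)) n)).
    apply: cvgB; first by apply: cvgB; exact: pser_cvg.
    by apply: cvgMl_tmp; exact: dcoef_cvg.
  apply/funext => n; rewrite /series !fctE /= mulr_sumr -!sumrB.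
  by apply: eq_bigr => i _; ring.
- by move=> n; rewrite /= !mulr_ge0 ?exprn_ge0.
- move=> n; rewrite normrM normr_toC.
  rewrite (_ : _ * `|w - z| ^+ 2 =
      `|a n|%:K * ((n%:R * n%:R * r%:K ^+ n) * `|w - z| ^+ 2)); last first.
    by rewrite !rmorphM rmorphXn rmorph_nat /=; ring.
  rewrite ler_wpM2l ?toC_ge0//; apply: exprB_taylor1 => //.
  by rewrite -(rmorph1 (@toC R)) ler_toC.
Qed.

Lemma normr_diff_quotient (F : numFieldType) (h x d : F) :
  h != 0 -> `|d - h^-1 * x| = `|h|^-1 * `|x - h * d|.
Proof.
move=> h0; rewrite -normfV -normrM mulrBr mulrA mulVf// mul1r.
by rewrite distrC.
Qed.

(** The quadratic remainder of [pser_taylor1], divided by [h], is at most [M * |h|]. The radius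
    [1 + |z|] covers every [z + h] with [|h| < 1]. *)
Lemma is_derive_pser (R : realType) (a : nat -> R) (z : Cplx R) :
  entire_coef a -> is_derive z (1 : Cplx R) (pser a) (pser (dcoef a) z).
Proof.
move=> ea; have [s s0 zs] := normr_toCP z.
have s1 : 1 <= 1 + s by rewrite lerDl.
have [M aM] := pser_taylor1 ea s1.
suff dq : h^-1 *: (pser a (h *: 1 + z) - pser a z) @[h --> (0 : Cplx R)^'] -->
    pser (dcoef a) z.
  apply: DeriveDef; first by apply/cvg_ex; exists (pser (dcoef a) z).
  by apply: cvg_lim dq; exact: norm_hausdorff.
have M0 : 0 < 1 + `|M| by rewrite (lt_le_trans ltr01)// lerDl.
apply/cvgrPdist_le => _ /gt0_toCP[e e0 ->]; near=> h.
have h0 : h != 0 by near: h; exact: nbhs_dnbhs_neq.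
have h1 : `|h| < 1 by near: h; exact: dnbhs0_lt.
have he : `|h| < (e / (1 + `|M|))%:K.
  by near: h; apply: dnbhs0_lt; rewrite toC_gt0 divr_gt0.
have := aM (h *: 1 + z) z.
rewrite addrK [h *: 1]mulr1 => H.
have {H} : `|pser a (h + z) - pser a z - h * pser (dcoef a) z| <= M%:K * `|h| ^+ 2.
  apply: H; last by rewrite zs ler_toC lerDr.
  apply: (le_trans (ler_normD _ _)).
  by rewrite rmorphD rmorph1 zs lerD// ltW.
rewrite /GRing.scale/= normr_diff_quotient// ler_pdivrMl ?normr_gt0// => H.
apply: (le_trans H).
rewrite expr2 mulrCA ler_wpM2l//.
apply: (@le_trans _ _ ((1 + `|M|)%:K * `|h|)).
  by rewrite ler_wpM2r// ler_toC (le_trans (ler_norm _))// lerDr.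
rewrite mulrC -ler_pdivlMr ?toC_gt0// -fmorphV -rmorphM.
exact: ltW.
Unshelve. all: by end_near.
Qed.

Lemma derive1_pser (R : realType) (a : nat -> R) :
  entire_coef a -> derive1 (pser a) = pser (dcoef a).
Proof.
move=> ea; apply/funext => z; rewrite derive1E.
exact: (derive_val (is_derive := is_derive_pser z ea)).
Qed.

(** * Iterated derivatives and falling factorials *)

Lemma entire_iter_dcoef (R : realType) (k : nat) (a : nat -> R) :
  entire_coef a -> entire_coef (iter k (@dcoef R) a).
Proof. by move=> ea; elim: k => //= k; exact: entire_dcoef. Qed.

Lemma derive1n_pser (R : realType) (k : nat) (a : nat -> R) :
  entire_coef a -> derive1n k (pser a) = pser (iter k (@dcoef R) a).
Proof.
move=> ea; elim: k => // k IH.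
by rewrite [LHS]/= -/(derive1n k _) IH derive1_pser//; exact: entire_iter_dcoef.
Qed.

Lemma iter_dcoefE (R : realType) (k : nat) (a : nat -> R) (n : nat) :
  iter k (@dcoef R) a n = ((n + k) ^_ k)%:R * a (n + k)%N.
Proof.
elim: k n => [|k IH] n; first by rewrite ffactn0 mul1r addn0.
by rewrite /= /dcoef IH ffactnSr addSnnS addnS subSn ?leq_addl// addnK mulrA -natrM mulnC.
Qed.

(** For [n < k] the falling factorial is already 0, so the subtraction can be taken in the ring,
    without truncation. *)
Lemma natr_ffactSr (F : pzRingType) (n k : nat) :
  (n ^_ k.+1)%:R = (n ^_ k)%:R * (n%:R - k%:R) :> F.
Proof.
rewrite ffactnSr natrM; have [kn|nk] := leqP k n; first by rewrite natrB.
by rewrite ffact_small// !mul0r.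
Qed.

Lemma entire_ffact (R : realType) (k : nat) (a : nat -> R) :
  entire_coef a -> entire_coef (fun n => (n ^_ k)%:R * a n).
Proof.
move=> ea; elim: k => [|k IH].
  by under eq_fun do rewrite ffactn0 mul1r.
rewrite (_ : (fun _ => _) =
    fun n => n%:R * ((n ^_ k)%:R * a n) + (- k%:R) * ((n ^_ k)%:R * a n)).
  exact: entire_coefD (entire_coefMn IH) (entire_coefZ _ IH).
by apply/funext => n; rewrite natr_ffactSr; ring.
Qed.

(** Multiplied by [z ^ k], the [k]-th derivative acts diagonally on coefficients; every term of
    [quotL] has this shape up to a constant. *)
Lemma pser_ffact (R : realType) (k : nat) (a : nat -> R) (z : Cplx R) :
  entire_coef a ->
  z ^+ k * pser (iter k (@dcoef R) a) z = pser (fun n => (n ^_ k)%:R * a n) z.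
Proof.
move=> ea; rewrite -[RHS](pser_shiftn (k := k)).
- by congr (_ * pser _ z); apply/funext => n; exact: iter_dcoefE.
- exact: entire_ffact.
- by move=> n nk; rewrite ffact_small// mul0r.
Qed.

Lemma lim_seriesDZ (R : realType) (k : R) (a b : nat -> R) :
  entire_coef a -> entire_coef b ->
  limn (series (fun n => a n + k * b n)) = limn (series a) + k * limn (series b).
Proof.
move=> ea eb; have ekb := entire_coefZ k eb.
have := pserD 1 ea ekb; rewrite pserZ// !pser1//; last exact: entire_coefD.
by rewrite -rmorphM -rmorphD => /complexI.
Qed.

Lemma entire_cvg (R : realType) (a : nat -> R) : entire_coef a -> cvgn (series a).
Proof. by move=> ea; apply: normed_cvg; exact: entire_abs_summable. Qed.

Lemma ler_lim_series (R : realType) (a b : nat -> R) :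
  entire_coef a -> entire_coef b -> (forall n, a n <= b n) ->
  limn (series a) <= limn (series b).
Proof. by move=> ea eb ab; apply: lim_series_le => //; exact: entire_cvg. Qed.

Lemma Re_gt_of_close (R : realType) (alpha : R) (q : Cplx R) :
  `|q - 1| < (1 - alpha)%:K -> alpha < complex.Re q.
Proof.
move=> q1; have := le_lt_trans (normr_Re _) q1; rewrite ltr_toC.
have -> : complex.Re (q - 1) = complex.Re q - 1 by case: (q).
by rewrite ltr_norml => /andP[+ _]; lra.
Qed.

(** * The coefficient criterion *)

(** With [m = n + 2], [c n.+1] is the coefficient [a_m] of [z ^ m] in [z * pser c z], so the assumed
    bound is [sum_(m >= 2) m (m - alpha) (1 + lambda (m - 1)) a_m <= 1 - alpha]. *)
Lemma classL_pser (R : realType) (c : nat -> R) (alpha lambda : R) :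
  entire_coef c -> (forall n, 0 <= c n) -> c 0%N = 1 ->
  0 <= alpha -> alpha < 1 -> 0 <= lambda ->
  limn (series (fun n => n.+2%:R * (n.+2%:R - alpha) * (1 + lambda * n.+1%:R) * c n.+1))
    <= 1 - alpha ->
  classL lambda alpha (fun z : Cplx R => z * pser c z).
Proof.
move=> ec c_ge0 c0 al0 al1 la0 hw.
(* [a] holds the coefficients of [f(z) = z * pser c z], [b] those of [f(z) - z], and [e] those of
   [(f(z) - z) / z ^ 2]. *)
pose e n := c n.+1; pose a n := if n is m.+1 then c m else 0.
pose b n := if n is m.+2 then e m else 0.
have ee : entire_coef e := entire_coefS ec.
have ea : entire_coef a := entire_coef_shift ec.
have bE : b = fun n => if n is m.+1 then (if m is p.+1 then e p else 0) else 0.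
  by apply/funext => -[|[|]].
have eb : entire_coef b by rewrite bE; do 2 apply: entire_coef_shift.
have e0 n : 0 <= e n := c_ge0 n.+1.
have fE : (fun z : Cplx R => z * pser c z) = pser a.
  apply/funext => z; rewrite (pser_recl z ea) rmorph0 add0r.
  by congr (_ * pser _ z).
have fbE z : pser a z = z + pser b z.
  rewrite -[pser a]fE (pser_recl z ec) c0 rmorph1 mulrDr mulr1; congr (_ + _).
  rewrite -[RHS](pser_shiftn (k := 2) z eb); last by case=> [|[|]].
  rewrite mulrA -expr2; congr (_ * pser _ z).
  by apply/funext => n; rewrite addn2.
(* [B n] and [n.+1%:R * B n] are the coefficients of [z ^ n.+2] in the denominator of the quotient
   and in numerator minus denominator. *)
pose B n := n.+2%:R * (1 + lambda * n.+1%:R) * e n.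
have epoly (p : {poly R}) : entire_coef (fun n => p.[n%:R] * e n).
  exact: entire_coef_horner.
have nS2 n : n.+2%:R = n%:R + 2 :> R by rewrite -addn2 natrD.
have nS1 n : n.+1%:R = n%:R + 1 :> R by rewrite natr1.
have eB : entire_coef B.
  have := epoly (('X + 2%:P) * (1 + lambda *: ('X + 1))).
  by congr entire_coef; apply/funext => n; rewrite /B (nS2 n) (nS1 n) !hornerE.
have eB1 : entire_coef (fun n => n.+1%:R * B n).
  have := entire_coefD (entire_coefMn eB) eB.
  by congr entire_coef; apply/funext => n; rewrite (nS1 n); ring.
have B0 n : 0 <= B n.
  by rewrite /B !mulr_ge0// addr_ge0// mulr_ge0.
have B10 n : 0 <= n.+1%:R * B n by rewrite mulr_ge0.
pose s := limn (series B); pose t := limn (series (fun n => n.+1%:R * B n)).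
have ts : t + (1 - alpha) * s <= 1 - alpha.
  rewrite -lim_seriesDZ//; apply: le_trans hw; rewrite le_eqVlt; apply/orP; left.
  apply/eqP; congr (limn (series _)); apply/funext => n.
  by rewrite /B /e (nS2 n) (nS1 n); ring.
split.
  rewrite fE; split.
  - by move=> z _; exact: (ex_derive (is_derive := is_derive_pser z ea)).
  - move=> w z; rewrite !inE /unit_disc /= => /ltW w1 /ltW z1.
    rewrite !fbE => wz.
    (* A Lipschitz constant of [f(z) - z] on the closed unit disc; injectivity follows once it is
       below 1. *)
    pose u := limn (series (fun n => n%:R * `|b n|)).
    have u1 : u < 1.
      have -> : u = limn (series (fun n => n.+2%:R * e n)).
        have enb : entire_coef (fun n => n%:R * `|b n|).
          have := entire_coefMn eb; congr entire_coef.
          by apply/funext => -[|[|n]] /=; rewrite ?normr0// ger0_norm.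
        rewrite /u (lim_series_recl enb) mul0r add0r (lim_series_recl (entire_coefS enb)).
        rewrite /= normr0 mulr0 add0r; congr (limn (series _)); apply/funext => n.
        by rewrite ger0_norm.
      have ee2 : entire_coef (fun n => n.+2%:R * e n).
        have := epoly ('X + 2%:P).
        by congr entire_coef; apply/funext => n; rewrite (nS2 n) !hornerE.
      have ew : entire_coef (fun n =>
          n.+2%:R * (n.+2%:R - alpha) * (1 + lambda * n.+1%:R) * c n.+1).
        have := entire_coefD eB1 (entire_coefZ (1 - alpha) eB).
        congr entire_coef; apply/funext => n.
        by rewrite /B /e (nS2 n) (nS1 n); ring.
      set U := limn _.
      (* Each weight of the hypothesis is at least [(2 - alpha) * n.+2], because
         [n.+2 - alpha >= 2 - alpha] and [1 + lambda * n.+1 >= 1]. The product [(2 - alpha) * U] is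
         split to suit [lim_seriesDZ]. *)
      have : U + (1 - alpha) * U <= 1 - alpha.
        rewrite -lim_seriesDZ//; apply: le_trans hw; apply: ler_lim_series => //.
          exact: entire_coefD (entire_coefZ _ ee2).
        move=> n; rewrite [leLHS](_ : _ = (2 - alpha) * (n.+2%:R * e n)); last by ring.
        rewrite [leRHS](_ : _ =
          (n.+2%:R - alpha) * (1 + lambda * n.+1%:R) * (n.+2%:R * e n)); last first.
          by rewrite /e; ring.
        rewrite ler_wpM2r ?mulr_ge0//.
        rewrite (nS2 n) (nS1 n); have n0 : 0 <= n%:R :> R by [].
        have : 0 <= lambda * (n%:R + 1) * (n%:R + 2 - alpha).
          by apply: mulr_ge0; [apply: mulr_ge0 => //|]; lra.
        lra.
      by move=> HU; rewrite ltNge; apply/negP => U1; nra.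
    have := pser_lipschitz eb w1 z1; rewrite -/u.
    have -> : pser b w - pser b z = z - w.
      by rewrite -[pser b w](addKr w) wz; ring.
    rewrite distrC; have [d d0 dE] := normr_toCP (w - z).
    rewrite dE -rmorphM ler_toC => du.
    have d00 : d = 0 by nra.
    by apply/eqP; rewrite -subr_eq0 -normr_eq0 dE d00 rmorph0.
  - by rewrite (pser_recl 0 ea) mul0r addr0.
  - by rewrite derive1_pser// (pser_recl 0 (entire_dcoef ea)) mul0r addr0 /dcoef /= mul1r c0.
move=> z; rewrite /unit_disc /= => z1; rewrite fE /quotL.
have [_|z0] := eqVneq z 0; first by [].
have dk k : z ^+ k * derive1n k (pser a) z = pser (fun n => (n ^_ k)%:R * a n) z.
  by rewrite derive1n_pser// pser_ffact.
set d1 := derive1 _ _; set d2 := derive1n 2 _ _; set d3 := derive1n 3 _ _.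
pose D := z * d1 + lambda%:K * (z ^+ 2 * d2).
(* [M] is the numerator of the quotient minus its denominator [D]. *)
pose M := lambda%:K * (z ^+ 3 * d3) + (1 + lambda)%:K * (z ^+ 2 * d2).
have f2 n : (n.+2 ^_ 2)%:R = n.+2%:R * n.+1%:R :> R by rewrite ffactSS ffactn1 natrM.
have f3 n : (n.+2 ^_ 3)%:R = n.+2%:R * n.+1%:R * n%:R :> R.
  by rewrite !ffactSS ffactn1 mulnA !natrM.
have DE : D = z + z ^+ 2 * pser B z.
  have d1E : z * d1 = pser (fun n => (n ^_ 1)%:R * a n) z := dk 1%N.
  have ef k := entire_ffact k ea.
  have eF := entire_coefD (ef 1%N) (entire_coefZ lambda (ef 2%N)).
  rewrite /D d1E dk -pserZ// -pserD//; last exact: entire_coefZ.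
  rewrite (pser_recl z eF) (pser_recl z (entire_coefS eF)) /= !mul0r mulr0 !add0r.
  rewrite ffactnn mul1r c0 addr0 rmorph1.
  rewrite mulrDr mulr1 mulrA expr2; congr (_ + _ * pser _ z); apply/funext => n.
  by rewrite ffactn1 f2 /B /e; ring.
have ME : M = z ^+ 2 * pser (fun n => n.+1%:R * B n) z.
  have ef k := entire_ffact k ea.
  have eG := entire_coefD (entire_coefZ lambda (ef 3%N)) (entire_coefZ (1 + lambda) (ef 2%N)).
  rewrite /M !dk -!pserZ// -pserD//; try exact: entire_coefZ.
  rewrite -(pser_shiftn (k := 2) z eG); last first.
    by case=> [|[|]] //= _; rewrite !mul0r !mulr0 addr0.
  congr (_ * pser _ z); apply/funext => n.
  by rewrite addn2 f2 f3 -[a n.+2]/(e n) /B (nS1 n); ring.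
set q := (X in complex.Re X).
have qE : q = (D + M) / D.
  have -> : q = (lambda%:K * z ^+ 3 * d3 + (1 + 2 * lambda)%:K * z ^+ 2 * d2 + z * d1)
      / (z * d1 + lambda%:K * z ^+ 2 * d2) by [].
  rewrite /D /M !rmorphD rmorphM rmorph1 rmorph_nat /=.
  by congr (_ / _); ring.
apply: Re_gt_of_close; rewrite qE.
have := pser_normC_le eB1 (ltW z1); have := pser_normC_le eB (ltW z1).
under eq_fun do rewrite (ger0_norm (B0 _)).
under [X in _ -> _ <= (limn (series X))%:K -> _]eq_fun do rewrite (ger0_norm (B10 _)).
rewrite -/s -/t => Bs Bt.
have [r r0 rE] := normr_toCP z; have [m m0 mE] := normr_toCP M.
have [d d0 dE] := normr_toCP D.
have rgt0 : 0 < r by rewrite -toC_gt0 -rE normr_gt0.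
have r1 : r < 1 by rewrite -ltr_toC -rE.
have mt : m <= r ^+ 2 * t.
  rewrite -ler_toC -mE ME normrM normrX rE rmorphM rmorphXn.
  by rewrite ler_wpM2l// exprn_ge0// toC_ge0.
have ds : r - r ^+ 2 * s <= d.
  rewrite -ler_toC -dE DE rmorphB rmorphM rmorphXn /= -rE.
  have := lerB_normD z (z ^+ 2 * pser B z); apply: le_trans.
  by rewrite lerB// normrM normrX ler_wpM2l ?exprn_ge0.
(* The chain is [m <= r^2 t <= r^2 (1 - alpha) - (1 - alpha) r^2 s < (1 - alpha) (r - r^2 s) <= (1 -
   alpha) d], strict because [0 < r < 1]. *)
have md : m < (1 - alpha) * d.
  have : r ^+ 2 * (t + (1 - alpha) * s) <= r ^+ 2 * (1 - alpha).
    by rewrite ler_wpM2l ?exprn_ge0.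
  have : r ^+ 2 * (1 - alpha) < r * (1 - alpha) by rewrite ltr_pM2r; nra.
  have : (1 - alpha) * (r - r ^+ 2 * s) <= (1 - alpha) * d by rewrite ler_wpM2l; lra.
  lra.
(* As [0 <= m], the strict bound also shows that the denominator does not vanish off 0. *)
have dgt0 : 0 < d by nra.
have D0 : D != 0 by rewrite -normr_gt0 dE toC_gt0.
rewrite (_ : (D + M) / D - 1 = M / D); last by field.
by rewrite normrM normfV mE dE ltr_pdivrMr ?toC_gt0// -rmorphM ltr_toC.
Qed.

(** * Euler's integral and the Bessel-Struve coefficients *)

Definition gamma_integrand (R : realType) (x t : R) : R := t `^ (x - 1) * expR (- t).

(** Kept in [\bar R] so that integrals can be compared before they are known to be finite; [fine],
    used in [Gamma], would send an infinite value to 0. *)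
Definition gamma_integral (R : realType) (x : R) : \bar R :=
  (\int[lebesgue_measure]_(t in `]0%R, +oo[) (gamma_integrand x t)%:E)%E.

Lemma GammaE (R : realType) (x : R) : Gamma x = fine (gamma_integral x).
Proof. by []. Qed.

Lemma gamma_integrand_ge0 (R : realType) (x t : R) : 0 <= gamma_integrand x t.
Proof. by rewrite mulr_ge0 ?powR_ge0 ?expR_ge0. Qed.

Lemma measurable_gamma_integrand (R : realType) (x : R) (A : set R) :
  measurable_fun A (fun t => (gamma_integrand x t)%:E).
Proof.
apply/measurable_EFinP; apply: measurable_funTS; apply: measurable_funM.
  exact: measurable_powR.
by apply: measurableT_comp; [exact: measurable_realfun.measurable_expR|exact: measurable_funN].
Qed.

Lemma gamma_integral_ge0 (R : realType) (x : R) : (0 <= gamma_integral x)%E.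
Proof.
by apply: integral_ge0 => t _; rewrite lee_fin gamma_integrand_ge0.
Qed.

Lemma powR_half_cvgy (R : realType) : (t : R) `^ (2^-1) @[t --> +oo] --> +oo.
Proof.
apply/cvgryPge => A; near=> t.
have t0 : 0 <= t by near: t; exact: nbhs_pinfty_ge.
rewrite powR12_sqrt//; apply: (le_trans (ler_norm A)); rewrite -sqrtr_sqr.
by apply: ler_wsqrtr; near: t; apply: nbhs_pinfty_ge; exact: num_real.
Unshelve. all: by end_near.
Qed.

Lemma continuous_powR (R : realType) (p x : R) :
  0 < x -> (t : R) `^ p @[t --> x] --> x `^ p.
Proof.
move=> x0; suff : {for x, continuous (fun t : R => t `^ p)} by [].
apply: differentiable_continuous; apply/derivable1_diffP.
by apply: derivable_powR; rewrite in_itv /= x0.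
Qed.

(* The substitution is run as [u = sqrt t] and away from [0] because the
   library's change of variables wants a derivative with a limit at [+oo] and
   at the left endpoint. *)
Lemma gamma_half_tail (R : realType) (a : R) : 0 < a ->
  (\int[lebesgue_measure]_(t in `[a, +oo[) (gamma_integrand (2^-1) t)%:E =
   \int[lebesgue_measure]_(u in `[(a `^ (2^-1))%R, +oo[) (2 * gauss_fun u)%:E)%E.
Proof.
move=> a0; pose F (t : R) := t `^ (2^-1).
have dF t : 0 < t -> derive1 F t = 2^-1 * t `^ (2^-1 - 1).
  by move=> t0; rewrite powR_derive1// in_itv /= t0.
have cF' (x : R) : a <= x -> F^`() t @[t --> x] --> 2^-1 * x `^ (2^-1 - 1).
  move=> ax; have x0 : 0 < x := lt_le_trans a0 ax.
  have c2 : 2^-1 * t `^ (2^-1 - 1) @[t --> x] --> 2^-1 * x `^ (2^-1 - 1).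
    by apply: cvgMl_tmp; exact: continuous_powR.
  apply: cvg_trans c2; apply: near_eq_cvg; near=> t; rewrite dF//.
  by near: t; exact: lt_nbhsr.
rewrite [RHS](@increasing_ge0_integration_by_substitutiony _ F (fun u => 2 * gauss_fun u) a).
(* Here [F' = t^(-1/2) / 2] and [gauss_fun (F t) = exp(-t)], whose product with 2 is the integrand
   at [x = 1/2]. *)
- apply: eq_integral => t; rewrite inE /= in_itv /= andbT => at_.
  have t0 : 0 < t := lt_le_trans a0 at_.
  congr (_%:E); rewrite fctE /= dF// /gauss_fun /F powR12_sqrt ?ltW// sqr_sqrtr ?ltW//.
  by rewrite /gamma_integrand; field.
- move=> x y; rewrite !in_itv /= !andbT => ax ay xy.
  by apply: gt0_ltr_powR => //; rewrite nnegrE (le_trans (ltW a0)).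
- move=> x; rewrite in_itv /= andbT => ax.
  rewrite /continuous_at dF ?(lt_trans a0)//; exact: cF' (ltW ax).
- apply/cvg_ex; exists (2^-1 * a `^ (2^-1 - 1)).
  by apply: cvg_at_right_filter; exact: cF'.
- apply/cvg_ex; exists (2^-1 * 0).
  have cV : ((t : R) `^ (2^-1))^-1 @[t --> +oo] --> (0 : R).
    apply/gtr0_cvgV0; last exact: powR_half_cvgy.
    by near=> t; apply: powR_gt0; near: t; exact: nbhs_pinfty_gt.
  have c2 : 2^-1 * ((t : R) `^ (2^-1))^-1 @[t --> +oo] --> (2^-1 * 0 : R).
    exact: cvgMl_tmp.
  apply: cvg_trans c2; apply: near_eq_cvg; near=> t; rewrite dF; last by near: t; exact: nbhs_pinfty_gt.
  rewrite -powRN; congr (_ * _ `^ _); lra.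
- split.
    move=> x; rewrite in_itv /= andbT => ax.
    by apply: derivable_powR; rewrite in_itv /= (lt_trans a0 ax).
  by apply: cvg_at_right_filter; exact: continuous_powR.
- exact: powR_half_cvgy.
- apply: continuous_subspaceT => x.
  by apply: cvgMl_tmp; exact: continuous_gauss_fun.
- by move=> x _; rewrite mulr_ge0// gauss_fun_ge0.
Unshelve. all: by end_near.
Qed.

(** Under [u = sqrt t] the rays [A k] and [B k] correspond by [gamma_half_tail]. Both families
    exhaust the open half-line, so monotone convergence carries the substitution down to 0, and the
    value is twice the half-line Gauss integral. *)
Lemma gamma_integral_half (R : realType) :
  gamma_integral (2^-1 : R) = (Num.sqrt pi)%:E.
Proof.
pose A (k : nat) : set R := `[(k.+1%:R^-1 : R), +oo[%classic.
pose B (k : nat) : set R := `[((k.+1%:R^-1 : R) `^ (2^-1)), +oo[%classic.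
have mg (C : set R) : measurable_fun C (fun u => (2 * gauss_fun u)%:E).
  apply/measurable_EFinP; apply: measurable_funTS; apply: measurable_funM => //.
  exact: measurable_gauss_fun.
have g0 (u : R) : (0 <= (2 * gauss_fun u)%:E)%E.
  by rewrite lee_fin mulr_ge0// gauss_fun_ge0.
have AU : `]0%R, +oo[%classic = \bigcup_k A k.
  rewrite itvoyEbigcup; apply: eq_bigcup => // k _.
  by rewrite /A add0r.
have BU : `]0%R, +oo[%classic = \bigcup_k B k.
  apply/seteqP; split=> [x|x [k _]]; rewrite /B /= !in_itv /= !andbT.
    move=> x0; have : `]0%R, +oo[%classic (x ^+ 2).
      by rewrite /= in_itv /= andbT exprn_gt0.
    rewrite AU => -[k _]; rewrite /A /= in_itv /= andbT => kx.
    exists k => //; rewrite /= in_itv /= andbT powR12_sqrt ?invr_ge0//.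
    by rewrite -[leRHS](ger0_norm (ltW x0)) -sqrtr_sqr ler_wsqrtr.
  by apply: lt_le_trans; rewrite powR_gt0// invr_gt0.
have kk (m n : nat) : (m <= n)%N -> (n.+1%:R^-1 : R) <= m.+1%:R^-1.
  by move=> mn; rewrite lef_pV2 ?posrE// ler_nat.
have cA : (\int[lebesgue_measure]_(t in A k) (gamma_integrand (2^-1) t)%:E)%E
    @[k --> \oo] --> gamma_integral (2^-1 : R).
  rewrite /gamma_integral AU; apply: ge0_nondecreasing_set_cvg_integral.
  - move=> m n mn; rewrite /A; apply/subsetPset => x /=; rewrite !in_itv /= !andbT.
    by apply: le_trans; exact: kk.
  - by move=> k; exact: measurable_itv.
  - by move=> k; exact: measurable_gamma_integrand.
  - by move=> k x _; rewrite lee_fin gamma_integrand_ge0.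
have cB : (\int[lebesgue_measure]_(u in B k) (2 * gauss_fun u)%:E)%E
    @[k --> \oo] --> (\int[lebesgue_measure]_(u in `]0%R, +oo[) (2 * gauss_fun u)%:E)%E.
  rewrite BU; apply: ge0_nondecreasing_set_cvg_integral => //.
  - move=> m n mn; apply/subsetPset => x; rewrite /B /= !in_itv /= !andbT.
    apply: le_trans; apply: ge0_ler_powR; rewrite ?nnegrE ?invr_ge0//.
    exact: kk.
  - by move=> k; exact: measurable_itv.
  - by move=> k; exact: mg.
have -> : gamma_integral (2^-1 : R) =
    (\int[lebesgue_measure]_(u in `]0%R, +oo[) (2 * gauss_fun u)%:E)%E.
  rewrite -(cvg_lim (@ereal_hausdorff R) cA) -(cvg_lim (@ereal_hausdorff R) cB).
  congr (limn _); apply/funext => k.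
  by apply: gamma_half_tail; rewrite invr_gt0.
rewrite integral_itv_obnd_cbnd; last exact: mg.
under eq_integral do rewrite EFinM.
rewrite ge0_integralZl//; last 2 first.
- by apply/measurable_EFinP; apply: measurable_funTS; exact: measurable_gauss_fun.
- by move=> u _; rewrite lee_fin gauss_fun_ge0.
by rewrite integral0y_gauss -EFinM; congr (_%:E); field.
Qed.

(** Pointwise, [t^(x - 1)] is at most [t^(-1/2)] for [t <= 1] and at most [t^(y - 1)] for [t >= 1];
    the first power contributes [sqrt(pi)]. *)
Lemma gamma_integral_le (R : realType) (x y : R) : 2^-1 <= x -> x <= y ->
  (gamma_integral x <= (Num.sqrt pi)%:E + gamma_integral y)%E.
Proof.
move=> hx xy; rewrite -gamma_integral_half /gamma_integral -ge0_integralD//; last 4 first.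
- by move=> t _; rewrite lee_fin gamma_integrand_ge0.
- exact: measurable_gamma_integrand.
- by move=> t _; rewrite lee_fin gamma_integrand_ge0.
- exact: measurable_gamma_integrand.
apply: ge0_le_integral => //.
- by move=> t _; rewrite lee_fin gamma_integrand_ge0.
- exact: measurable_gamma_integrand.
- by apply: emeasurable_funD; exact: measurable_gamma_integrand.
move=> t; rewrite /= in_itv /= andbT => t0; rewrite -EFinD lee_fin.
rewrite /gamma_integrand -mulrDl ler_wpM2r ?expR_ge0//.
have [t1|/ltW t1] := leP t 1.
  rewrite (@le_trans _ _ (t `^ (2^-1 - 1)))//; last by rewrite lerDl powR_ge0.
  by apply: ger_powR; rewrite ?t0 ?t1// lerD2r.
rewrite (@le_trans _ _ (t `^ (y - 1)))//; last by rewrite lerDr powR_ge0.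
by apply: ler_powR => //; rewrite lerD2r.
Qed.

(** Half of the decay of [exp(-t)] absorbs the power, by [(t/2)^(n+1) <= (n+1)! exp(t/2)]; the other
    half is a multiple of the exponential density of rate 1/2, whose mass is 1. *)
Lemma gamma_integral_nat_fin (R : realType) (n : nat) :
  (gamma_integral (n.+2%:R : R) < +oo)%E.
Proof.
(* The last factor 2 cancels the rate 1/2 that stands in front of the density. *)
pose C : R := n.+1`!%:R * 2 ^+ n.+1 * 2.
have C0 : 0 <= C by rewrite !mulr_ge0.
have mpdf (A : set R) : measurable_fun A (fun t => (exponential_pdf (2^-1) t)%:E).
  by apply/measurable_EFinP; apply: measurable_funTS; exact: measurable_exponential_pdf.
have pdf0 (t : R) : (0 <= (exponential_pdf (2^-1) t)%:E)%E.
  by rewrite lee_fin exponential_pdf_ge0.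
apply: (@le_lt_trans _ _
  (\int[lebesgue_measure]_(t in `]0%R, +oo[) (C%:E * (exponential_pdf (2^-1) t)%:E))%E).
  apply: ge0_le_integral => //.
  - by move=> t _; rewrite lee_fin gamma_integrand_ge0.
  - exact: measurable_gamma_integrand.
  - by apply: measurable_funeM; exact: mpdf.
  move=> t; rewrite /= in_itv /= andbT => t0; rewrite -EFinM lee_fin.
  rewrite (exponential_pdfE _ (ltW t0)) /gamma_integrand.
  have -> : n.+2%:R - 1 = n.+1%:R :> R by rewrite -[n.+2%:R]natr1 addrK.
  rewrite (powR_mulrn _ (ltW t0)).
  have e2 : expR (- t) = expR (- 2^-1 * t) * expR (- (t / 2)).
    by rewrite -expRD; congr expR; field.
  have u0 : 0 <= t / 2 by rewrite divr_ge0// ltW.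
  have un : (t / 2) ^+ n.+1 <= n.+1`!%:R * expR (t / 2).
    rewrite [leRHS]mulrC -ler_pdivrMr ?ltr0n ?fact_gt0//.
    by apply: le_trans (expR_ge1Dxn n u0); rewrite lerDr.
  have -> : t ^+ n.+1 = 2 ^+ n.+1 * (t / 2) ^+ n.+1 by rewrite -exprMn mulrC divfK.
  rewrite e2 [leLHS](_ : _ = 2 ^+ n.+1 * expR (- 2^-1 * t) *
      ((t / 2) ^+ n.+1 * expR (- (t / 2)))); last by ring.
  rewrite [leRHS](_ : _ = 2 ^+ n.+1 * expR (- 2^-1 * t) * n.+1`!%:R); last first.
    by rewrite /C; field.
  rewrite ler_wpM2l ?mulr_ge0 ?exprn_ge0 ?expR_ge0//.
  by rewrite expRN ler_pdivrMr ?expR_gt0.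
rewrite ge0_integralZl//; last exact: mpdf.
apply: (@le_lt_trans _ _ (C%:E * 1)%E); last by rewrite mule1 ltry.
apply: lee_wpmul2l; first by rewrite lee_fin.
rewrite -(@integral_exponential_pdf R (2^-1)) ?invr_gt0//.
by apply: ge0_subset_integral => //; exact: mpdf.
Qed.

(** Some integer that is at least 2 lies above [x]; the integral is finite there, and
    [gamma_integral_le] brings finiteness down to [x]. *)
Lemma gamma_integral_fin_num (R : realType) (x : R) : 2^-1 <= x ->
  gamma_integral x \is a fin_num.
Proof.
move=> hx; rewrite ge0_fin_numE ?gamma_integral_ge0//.
have xn : x <= (Num.truncn x).+2%:R.
  by rewrite (le_trans (ltW (truncnS_gt x)))// ler_nat.
apply: le_lt_trans (gamma_integral_le hx xn) _.
by rewrite lte_add_pinfty ?ltry// gamma_integral_nat_fin.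
Qed.

Lemma Gamma_half (R : realType) : Gamma (1 / 2 : R) = Num.sqrt pi.
Proof. by rewrite GammaE mul1r gamma_integral_half. Qed.

Lemma Gamma_ge0 (R : realType) (x : R) : 0 <= Gamma x.
Proof. by rewrite GammaE fine_ge0// gamma_integral_ge0. Qed.

Lemma Gamma_le (R : realType) (x y : R) : 2^-1 <= x -> x <= y ->
  Gamma x <= Num.sqrt pi + Gamma y.
Proof.
move=> hx xy; have hy := le_trans hx xy.
rewrite !GammaE -lee_fin EFinD !fineK ?gamma_integral_fin_num//.
exact: gamma_integral_le.
Qed.

(** On [[1, 2]] one has [t^(x - 1) >= t^(-1) >= 1/2] and [exp(-t) >= exp(-2)]. The bound is uniform
    in [x], as the ratio estimate needs. *)
Lemma Gamma_lower (R : realType) (x : R) : 2^-1 <= x -> expR (- 2) / 2 <= Gamma x.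
Proof.
move=> hx; rewrite GammaE -lee_fin fineK ?gamma_integral_fin_num//.
apply: (@le_trans _ _ (\int[lebesgue_measure]_(t in `[1%R, 2%R]) (expR (- 2) / 2)%:E)%E).
  rewrite integral_cst//= lebesgue_measure_itv /= lte_fin ltr1n /= -EFinB -EFinM lee_fin.
  lra.
apply: (@le_trans _ _ (\int[lebesgue_measure]_(t in `[1%R, 2%R]) (gamma_integrand x t)%:E)%E).
  apply: ge0_le_integral => //.
  - exact: measurable_gamma_integrand.
  move=> t; rewrite /= in_itv /= => /andP[t1 t2]; rewrite lee_fin.
  have t0 : 0 < t := lt_le_trans ltr01 t1.
  rewrite /gamma_integrand mulrC ler_pM ?invr_ge0 ?expR_ge0//; last first.
    by rewrite ler_expR lerN2.
  apply: (@le_trans _ _ (t `^ (- 1))).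
    by rewrite (powR_inv1 (ltW t0)) lef_pV2 ?posrE.
  by apply: ler_powR => //; lra.
apply: ge0_subset_integral => //.
- exact: measurable_gamma_integrand.
- by move=> t _; rewrite lee_fin gamma_integrand_ge0.
- move=> t; rewrite /= !in_itv /= andbT => /andP[t1 _].
  exact: lt_le_trans ltr01 t1.
Qed.

Lemma Gamma_gt0 (R : realType) (x : R) : 2^-1 <= x -> 0 < Gamma x.
Proof.
by move=> hx; rewrite (lt_le_trans _ (Gamma_lower hx))// divr_gt0 ?expR_gt0.
Qed.

(** Dividing [Gamma_le] by [Gamma y] leaves [sqrt(pi) / Gamma y + 1], and [Gamma_lower] controls the
    first term. *)
Lemma Gamma_ratio_bounded (R : realType) : exists M : R,
  forall x y, 2^-1 <= x -> x <= y -> Gamma x / Gamma y <= M.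
Proof.
exists (Num.sqrt pi / (expR (- 2) / 2) + 1) => x y hx xy.
have hy := le_trans hx xy; have Gy := Gamma_gt0 hy.
rewrite ler_pdivrMr// mulrDl mul1r; apply: le_trans (Gamma_le hx xy) _.
rewrite lerD2r -mulrA ler_peMr ?sqrtr_ge0// mulrC ler_pdivlMr ?mul1r.
  exact: Gamma_lower.
by rewrite divr_gt0 ?expR_gt0.
Qed.

(** * The Bessel-Struve coefficients and the final assembly *)

Lemma struve_coef_ge0 (R : realType) (nu : R) (n : nat) : 0 <= struve_coef nu n.
Proof. by rewrite divr_ge0 ?mulr_ge0 ?Gamma_ge0 ?sqrtr_ge0. Qed.

Lemma struve_coef0 (R : realType) (nu : R) : - (1 / 2) < nu -> struve_coef nu 0 = 1.
Proof.
move=> hnu; rewrite /struve_coef Gamma_half mul0r add0r fact0 mulr1 [X in _ / X]mulrC divff//.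
have sp : 0 < Num.sqrt (pi : R) by rewrite sqrtr_gt0 pi_gt0.
by rewrite gt_eqF// mulr_gt0// Gamma_gt0//; lra.
Qed.

(** Times [r ^ n], the coefficient splits into a constant, a bounded ratio of Gamma values, and
    [r^n / n! <= exp(r)]. *)
Lemma entire_struve_coef (R : realType) (nu : R) :
  - (1 / 2) < nu -> entire_coef (struve_coef nu).
Proof.
move=> hnu r r0; have [M HM] := Gamma_ratio_bounded R.
have G0 : 0 <= Gamma (nu + 1) / Num.sqrt pi by rewrite divr_ge0 ?Gamma_ge0 ?sqrtr_ge0.
have rn n : r ^+ n / n`!%:R <= expR r.
  case: n => [|n].
    by rewrite expr0 fact0 divr1 (le_trans _ (expR_ge1Dx r))// lerDl.
  by apply: le_trans (expR_ge1Dxn n r0); rewrite lerDr.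
exists (Gamma (nu + 1) / Num.sqrt pi * M * expR r) => n.
rewrite ger0_norm ?struve_coef_ge0//.
have -> : struve_coef nu n * r ^+ n = Gamma (nu + 1) / Num.sqrt pi *
    (Gamma (n.+1%:R / 2) / Gamma (n%:R / 2 + nu + 1)) * (r ^+ n / n`!%:R).
  by rewrite /struve_coef !invfM; ring.
have n0 : 0 <= n%:R :> R by [].
apply: ler_pM => //.
- by rewrite mulr_ge0// divr_ge0 ?Gamma_ge0.
- by rewrite divr_ge0 ?exprn_ge0.
(* The condition on [nu] orders the two arguments: [1/2 <= (n + 1)/2 <= n/2 + nu + 1]. *)
rewrite ler_wpM2l//; apply: HM; rewrite -[n.+1%:R]natr1; lra.
Qed.

(* The derivatives of struve nu at 1 are real numbers, read off by Re. *)
Theorem theorem2p2 (R : realType) (nu alpha lambda : R)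
  (hnu : - (1 / 2) < nu)
  (halpha0 : 0 <= alpha) (halpha1 : alpha < 1)
  (hlambda0 : 0 <= lambda) (hlambda1 : lambda < 1)
  (hS : lambda * complex.Re (derive1n 3 (struve nu) 1)
        + (5 * lambda + 1 - lambda * alpha) * complex.Re (derive1n 2 (struve nu) 1)
        + (4 * lambda - 2 * lambda * alpha - alpha + 3)
            * complex.Re (derive1 (struve nu) 1)
        + (1 - alpha) * complex.Re (struve nu 1)
        <= 2 * (1 - alpha)) :
  classL lambda alpha (fun z : Cplx R => z * struve nu z).
Proof.
set c := struve_coef nu; have ec : entire_coef c := entire_struve_coef hnu.
have c0 : c 0%N = 1 := struve_coef0 hnu.
apply: (@classL_pser R c) => //; first exact: struve_coef_ge0.
(* [g k] lists the coefficients of [z ^ k] times the [k]-th derivative of [struve nu], so its sum is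
   that derivative at 1. *)
pose g k n : R := (n ^_ k)%:R * c n.
have eg k : entire_coef (g k) := entire_ffact k ec.
have dg k : complex.Re (derive1n k (struve nu) 1) = limn (series (g k)).
  have -> : derive1n k (struve nu) 1 = (limn (series (g k)))%:K; last by [].
  rewrite -(pser1 (eg k)) -[RHS]pser_ffact// expr1n mul1r.
  by rewrite -(derive1n_pser k ec).
pose w n := n.+1%:R * (n.+1%:R - alpha) * (1 + lambda * n%:R) * c n.
(* The cubic weight is expanded in falling factorials: the coefficients are those of the hypothesis,
   with [1 - alpha] split as [1 + - alpha] for [lim_seriesDZ]. *)
have gE : w = fun n => g 0%N n + - alpha * g 0%N n
    + (4 * lambda - 2 * lambda * alpha - alpha + 3) * g 1%N n
    + (5 * lambda + 1 - lambda * alpha) * g 2%N n + lambda * g 3%N n.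
  apply/funext => n; rewrite /w /g !natr_ffactSr ffactn0 -[n.+1%:R]natr1; ring.
have e0 := entire_coefD (eg 0%N) (entire_coefZ (- alpha) (eg 0%N)).
have e1 := entire_coefD e0
  (entire_coefZ (4 * lambda - 2 * lambda * alpha - alpha + 3) (eg 1%N)).
have e2 := entire_coefD e1 (entire_coefZ (5 * lambda + 1 - lambda * alpha) (eg 2)).
have ew : entire_coef w by rewrite gE; exact: entire_coefD e2 (entire_coefZ _ (eg 3)).
have wS : limn (series w) <= 2 * (1 - alpha).
  have h0 : complex.Re (struve nu 1) = limn (series (g 0%N)) := dg 0%N.
  have h1 : complex.Re (derive1 (struve nu) 1) = limn (series (g 1%N)) := dg 1%N.
  (* Substitution is done through this implication: rewriting under [derive1n]
     makes the unifier unfold the derivatives. *)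
  have subst4 (r0 r1 r2 r3 x0 x1 x2 x3 : R) : r0 = x0 -> r1 = x1 -> r2 = x2 -> r3 = x3 ->
      lambda * r3 + (5 * lambda + 1 - lambda * alpha) * r2
        + (4 * lambda - 2 * lambda * alpha - alpha + 3) * r1 + (1 - alpha) * r0
        <= 2 * (1 - alpha) ->
      x0 + - alpha * x0 + (4 * lambda - 2 * lambda * alpha - alpha + 3) * x1
        + (5 * lambda + 1 - lambda * alpha) * x2 + lambda * x3 <= 2 * (1 - alpha).
    by clear -alpha lambda => -> -> -> ->; lra.
  by rewrite gE !lim_seriesDZ//; exact: subst4 h0 h1 (dg 2) (dg 3) hS.
suff : limn (series (fun n => w n.+1)) <= 1 - alpha by [].
(* The term [n = 0], the coefficient of [z] in [z * struve nu z], uses up half of the bound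
   [2 * (1 - alpha)]. *)
have w0 : w 0%N = 1 - alpha by rewrite /w c0 mulr0 addr0 !mulr1 mul1r.
have wE : limn (series w) = 1 - alpha + limn (series (fun n => w n.+1)).
  by rewrite -w0; exact: lim_series_recl.
have tail_le (x y t : R) : x = y + t -> x <= 2 * y -> t <= y.
  by clear; move=> ->; lra.
exact: tail_le wE wS.
Qed.
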